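(* Let $X$ be a strongly $0$-dimensional metrizable space with $\operatorname{card}(X)\le\mathfrak{c}$. Then $\mathrm{SR}(X)$ is dense in $(\mathrm{Met}(X),\mathcal{D}_X)$. Moreover, if $X$ is $\sigma$-compact, then $\mathrm{SR}(X)$ is a dense $G_\delta$ subset of $(\mathrm{Met}(X),\mathcal{D}_X)$.
   Context: For a topological space $X$, $\mathrm{Met}(X)$ denotes the set of all metrics on $X$ generating the topology of $X$, equipped with the supremum metric $\mathcal{D}_X(d,e)=\sup_{x,y\in X}|d(x,y)-e(x,y)|$ (values in $[0,\infty]$) and the topology generated by its open balls. $\mathfrak{c}$ is the cardinality of the continuum. A topological space is strongly $0$-dimensional if for every pair $A,B$ of disjoint closed subsets there is a clopen set $V$ with $A\subseteq V$, $V\cap B=\emptyset$. A metric $d$ on a set $X$ is strongly rigid if for all $x,y,u,v\in X$, $d(x,y)=d(u,v)\neq0$ implies $\{x,y\}=\{u,v\}$. $\mathrm{SR}(X)$ is the set of all strongly rigid metrics in $\mathrm{Met}(X)$. A $G_\delta$ set is a countable intersection of open sets. *)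

(* Defs.v *)
From HB Require Import structures.
From mathcomp Require Import all_boot all_order all_algebra.
From mathcomp Require Import all_classical all_reals all_analysis.
From mathcomp Require Import Rstruct Rstruct_topology.
Set Implicit Arguments. Unset Strict Implicit. Unset Printing Implicit Defensive.
Import Order.TTheory GRing.Theory Num.Theory.
Local Open Scope classical_set_scope.
Local Open Scope ring_scope.

Notation RR := Rdefinitions.R.

Definition is_metric (T : Type) (d : T -> T -> RR) : Prop :=
  (forall x y, 0 <= d x y) /\
  (forall x y, d x y = 0 <-> x = y) /\
  (forall x y, d x y = d y x) /\
  (forall x y z, d x z <= d x y + d y z).

Definition generates_topology (T : topologicalType) (d : T -> T -> RR) : Prop :=
  forall A : set T, open A <->
    (forall x, A x -> exists2 e : RR, 0 < e & forall y, d x y < e -> A y).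

Definition Met (T : topologicalType) : set (T -> T -> RR) :=
  [set d | is_metric d /\ generates_topology d].
Arguments Met : clear implicits.

Definition metrizable (T : topologicalType) : Prop := exists d, Met T d.

Definition supdist (T : Type) (d e : T -> T -> RR) : \bar RR :=
  ereal_sup [set ((`|d xy.1 xy.2 - e xy.1 xy.2|)%:E) | xy in [set: T * T]].

Definition Met_open (T : topologicalType) (U : set (T -> T -> RR)) : Prop :=
  U `<=` Met T /\
  forall d, U d -> exists2 eps : RR, 0 < eps &
    forall e, Met T e -> (supdist d e < eps%:E)%E -> U e.

Definition Met_dense (T : topologicalType) (S : set (T -> T -> RR)) : Prop :=
  S `<=` Met T /\
  forall d, Met T d -> forall eps : RR, 0 < eps ->
    exists2 e, S e & (supdist d e < eps%:E)%E.

Definition Met_Gdelta (T : topologicalType) (S : set (T -> T -> RR)) : Prop :=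
  exists U : nat -> set (T -> T -> RR),
    (forall n, Met_open (U n)) /\ S = \bigcap_n U n.

Definition strongly_rigid (T : Type) (d : T -> T -> RR) : Prop :=
  forall x y u v, d x y = d u v -> d x y != 0 -> [set x; y] = [set u; v].

Definition SR (T : topologicalType) : set (T -> T -> RR) :=
  [set d | Met T d /\ strongly_rigid d].
Arguments SR : clear implicits.

Definition strongly_zero_dim (T : topologicalType) : Prop :=
  forall A B : set T, closed A -> closed B -> A `&` B = set0 ->
    exists V : set T, clopen V /\ A `<=` V /\ V `&` B = set0.

Definition card_le_continuum (T : Type) : Prop :=
  exists f : T -> RR, injective f.

Definition sigma_compact (T : topologicalType) : Prop :=
  exists K : nat -> set T, (forall n, compact (K n)) /\ \bigcup_n K n = [set: T].

(* Main.v *)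
Require Import Defs.
From mathcomp Require Import all_boot all_order all_algebra.
From mathcomp Require Import all_classical all_reals all_analysis.
From mathcomp Require wochoice.
From mathcomp Require Import Rstruct Rstruct_topology lra.

(** Density. Given a metric [d] and [c > 0], strong zero-dimensionality yields
    a locally constant map [p] moving points by less than [c].  Rounding up,
    [c * ceil (d (p x) (p y) / c)] is a locally constant pseudometric close to
    [d], with values in the multiples of [c].  Add to it [c * w], where [w] is a
    metric with values in [0, 1/2[ written in base 4 with digits 0 and 1, the
    [n]-th digit of [w x y] telling whether a locally constant map [h n]
    separates [x] from [y].  A value of the sum determines [w x y] (the
    fractional part, up to the factor [c]), hence all digits, hence [{x, y}]
    once the family [h] is rich enough: since [card T] is at most the continuum,
    the points of [T] can be named by binary sequences all of whose bits are
    locally constant.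

    G_delta. A metric is continuous, so taking distinct values at the two pairs of
    every [((x, y), (u, v))] in a compact set [L] is an open condition on it.
    Countably many such [L] exhaust the quadruples with [x <> y] and
    [{x, y} <> {u, v}]. *)

Set Implicit Arguments. Unset Strict Implicit. Unset Printing Implicit Defensive.
Import Order.TTheory GRing.Theory Num.Theory.
Import numFieldNormedType.Exports.
Local Open Scope classical_set_scope.
Local Open Scope ring_scope.

(** * Base-4 expansions with digits 0 and 1 *)

Section DigitSum.
Variable R : realType.
Implicit Types (g : nat -> bool) (n : nat).

Definition digit_psum g n : R := \sum_(i < n) (g i)%:R / 4 ^+ i.+1.
Definition digit_sum g : R := sup (range (digit_psum g)).

Lemma digit_psumS g n : digit_psum g n.+1 = digit_psum g n + (g n)%:R / 4 ^+ n.+1.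
Proof. by rewrite /digit_psum big_ord_recr. Qed.

Lemma eq_digit_psum g g' n :
  (forall i, (i < n)%N -> g i = g' i) -> digit_psum g n = digit_psum g' n.
Proof. by move=> gg'; apply: eq_bigr => i _; rewrite gg'. Qed.

Lemma inv_expr4S n : (4 ^+ n.+1)^-1 = (4 ^+ n)^-1 / 4 :> R.
Proof. by rewrite exprSr invfM mulrC. Qed.

(** The subtracted term makes the bound the exact tail with all digits equal to 1, which lets the
    induction on [k] go through. *)
Lemma digit_psum_tail g n k :
  digit_psum g n <= digit_psum g (n + k)
    <= digit_psum g n + ((4 ^+ n)^-1 - (4 ^+ (n + k))^-1) / 3.
Proof.
elim: k => [|k]; first by rewrite addn0; lra.
rewrite addnS digit_psumS inv_expr4S.
have : (0 : R) < (4 ^+ (n + k))^-1 by rewrite invr_gt0 exprn_gt0.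
by case: (g _); rewrite /= ?mul0r ?mul1r; lra.
Qed.

Lemma digit_psum_bounds g n m :
  digit_psum g m <= digit_psum g n + (4 ^+ n)^-1 / 3.
Proof.
have pos k : (0 : R) < (4 ^+ k)^-1 by rewrite invr_gt0 exprn_gt0.
case: (leqP n m) => [/subnKC <-|/ltnW /subnKC <-].
  have := digit_psum_tail g n (m - n); have := pos (n + (m - n))%N; lra.
have := digit_psum_tail g m (n - m); have := pos (m + (n - m))%N; lra.
Qed.

Lemma digit_psum_le g n : digit_psum g n <= digit_sum g.
Proof.
apply: sup_upper_bound; last by exists n.
split; first by exists (digit_psum g 0), 0%N.
by exists (digit_psum g 0 + (4 ^+ 0)^-1 / 3) => _ [m _ <-]; exact: digit_psum_bounds.
Qed.

Lemma digit_sum_le g n : digit_sum g <= digit_psum g n + (4 ^+ n)^-1 / 3.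
Proof.
apply: ge_sup; first by exists (digit_psum g 0), 0%N.
by move=> _ [m _ <-]; exact: digit_psum_bounds.
Qed.

Lemma digit_sum_ge0 g : 0 <= digit_sum g.
Proof. by have := digit_psum_le g 0; rewrite /digit_psum big_ord0. Qed.

Lemma digit_sum_lt_half g : digit_sum g < 2^-1.
Proof. have := digit_sum_le g 0; rewrite /digit_psum big_ord0 expr0 invr1; lra. Qed.

Lemma digit_sum_small g n :
  (forall i, (i < n)%N -> g i = false) -> digit_sum g <= (4 ^+ n)^-1.
Proof.
move=> g0; apply: le_trans (digit_sum_le g n) _.
have -> : digit_psum g n = 0 by apply: big1 => i _; rewrite g0// mul0r.
have : (0 : R) < (4 ^+ n)^-1 by rewrite invr_gt0 exprn_gt0.
lra.
Qed.

Lemma digit_sum0 g : (forall i, g i = false) -> digit_sum g = 0.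
Proof.
move=> g0; apply/eqP; rewrite eq_le digit_sum_ge0 andbT.
by apply: ge_sup => [|_ [m _ <-]]; [exists (digit_psum g 0), 0%N|rewrite /digit_psum big1// => i _; rewrite g0 mul0r].
Qed.

Lemma digit_sum_large g n : g n -> (4 ^+ n.+1)^-1 <= digit_sum g.
Proof.
move=> gn; apply: le_trans (digit_psum_le g n.+1).
rewrite digit_psumS gn mul1r lerDr.
by apply: sumr_ge0 => i _; rewrite divr_ge0// exprn_ge0.
Qed.

(** The inequality holds digit by digit, hence for partial sums; no carrying is involved. *)
Lemma digit_sum_triangle g g1 g2 :
  (forall i, g i -> g1 i || g2 i) -> digit_sum g <= digit_sum g1 + digit_sum g2.
Proof.
move=> gle; apply: ge_sup => [|_ [m _ <-]]; first by exists (digit_psum g 0), 0%N.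
apply: (@le_trans _ _ (digit_psum g1 m + digit_psum g2 m)); last by rewrite lerD ?digit_psum_le.
rewrite -big_split; apply: ler_sum => i _ /=.
rewrite -mulrDl ler_pM2r ?invr_gt0 ?exprn_gt0//.
have := gle i; case: (g i); case: (g1 i); case: (g2 i) => /= h; first [lra | by have := h isT].
Qed.

(** Digit [n] is worth [1 / 4 ^ n.+1], and all later digits together at most a third of that, so the
    first difference decides. *)
Lemma digit_sum_lt g g' n : (forall i, (i < n)%N -> g i = g' i) ->
  g n = false -> g' n -> digit_sum g < digit_sum g'.
Proof.
move=> /eq_digit_psum gg' gn g'n.
have := digit_sum_le g n.+1; have := digit_psum_le g' n.+1.
have : (0 : R) < (4 ^+ n.+1)^-1 by rewrite invr_gt0 exprn_gt0.
rewrite !digit_psumS gg' gn g'n /= mul1r mul0r; lra.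
Qed.

Lemma digit_sum_inj g g' : digit_sum g = digit_sum g' -> g =1 g'.
Proof.
move=> eS n; apply: contrapT => /eqP gn.
have ex : exists n, g n != g' n by exists n.
case: (ex_minnP ex) => m gm minm.
have ge i : (i < m)%N -> g i = g' i.
  by move=> im; apply/eqP; apply: contraTT im => /minm; rewrite -leqNgt.
case gE : (g m) gm; case gE' : (g' m) => // _.
- suff : digit_sum g' < digit_sum g by rewrite eS ltxx.
  by apply: (@digit_sum_lt _ _ m) => // i /ge.
- suff : digit_sum g < digit_sum g' by rewrite eS ltxx.
  exact: (@digit_sum_lt _ _ m).
Qed.

(** Both digit sums lie in [0, 1/2[, so the two integers differ by less than 1. *)
Lemma int_plus_digits_inj (m m' : int) g g' :
  m%:~R + digit_sum g = m'%:~R + digit_sum g' -> g =1 g'.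
Proof.
have := digit_sum_ge0 g; have := digit_sum_ge0 g'.
have := digit_sum_lt_half g; have := digit_sum_lt_half g'.
move=> g'1 g1 g'0 g0 E.
have mE : m = m'.
  apply/eqP; rewrite eq_le -!ltzD1 -!(ltr_int R) !rmorphD /=.
  by apply/andP; split; lra.
by apply: digit_sum_inj; move: E; rewrite mE => /addrI.
Qed.

End DigitSum.

(** * Metrics generating the topology *)

Section MetricTopology.
Variables (T : topologicalType) (d : T -> T -> RR).
Hypothesis Md : Met T d.

Lemma Met_ge0 x y : 0 <= d x y.
Proof. by case: Md => -[]. Qed.

Lemma Met_eq0 x y : d x y = 0 <-> x = y.
Proof. by case: Md => -[_ []]. Qed.

Lemma Met_xx x : d x x = 0.
Proof. exact/Met_eq0. Qed.

Lemma Met_sym x y : d x y = d y x.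
Proof. by case: Md => -[_ [_ []]]. Qed.

Lemma Met_triangle y x z : d x z <= d x y + d y z.
Proof. by case: Md => -[_ [_ [_ +]]] _; exact. Qed.

Lemma Met_ball_open x r : open [set y | d x y < r].
Proof.
apply/(proj2 Md) => y /= xy; exists (r - d x y); first by rewrite subr_gt0.
by move=> z yz; have := Met_triangle y x z; lra.
Qed.

Lemma Met_nbhsP x (A : set T) :
  nbhs x A <-> exists2 e : RR, 0 < e & forall y, d x y < e -> A y.
Proof.
split=> [|[e e0 eA]].
  rewrite nbhsE => -[B [oB Bx] BA]; have [e e0 eB] := (proj1 (proj2 Md B) oB) x Bx.
  by exists e => // y /eB /BA.
rewrite nbhsE; exists [set y | d x y < e] => //.
by split; [exact: Met_ball_open|rewrite /= Met_xx].
Qed.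

End MetricTopology.

Lemma exists_invS_lt (R : realType) (e : R) : 0 < e -> exists n, n.+1%:R^-1 < e.
Proof. by move=> e0; have /filter_ex := near_infty_natSinv_lt (PosNum e0). Qed.

(** * Clopen partitions and locally constant maps *)

Definition locally_constant (T : topologicalType) (A : Type) (h : T -> A) :=
  forall x, \forall y \near x, h y = h x.

(* [m x] is the least index of a member of the cover containing [x]; the second
   property is all that is needed of the underlying well-order. *)
Lemma exists_minimal_choice (T I : Type) (U : I -> set T) :
  (forall x, exists i, U i x) ->
  exists m : T -> I, (forall x, U (m x) x) /\
    (forall x y, U (m x) y -> U (m y) x -> m x = m y).
Proof.
move=> Ucov; have [le wo] := wochoice.well_ordering_principle {classic I}.
have least x : exists i, U i x /\ (forall j, U j x -> le i j).
  have [i0 Ui0] := Ucov x.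
  have [|i [[/asboolP Ui lei] _]] := wo (fun i => `[< U i x >]).
    by exists i0; apply/asboolP.
  by exists i; split=> // j Uj; apply: lei; apply/asboolP.
have [m mP] := choice least.
exists m; split=> [x|x y Uxy Uyx]; first by case: (mP x).
have lexy : le (m x) (m y) by apply: (mP x).2.
have leyx : le (m y) (m x) by apply: (mP y).2.
have refl i : le i i.
  have [|z [[/asboolP-> +] _]] := wo (fun j => `[< j = i >]).
    by exists i; apply/asboolP.
  by apply; apply/asboolP.
have [|z [_ zu]] := wo (fun j => `[< j = m x \/ j = m y >]).
  by exists (m x); apply/asboolP; left.
rewrite -(zu (m x)); first apply: zu.
  by split=> [|j /asboolP[->|->]] //; apply/asboolP; right.
by split=> [|j /asboolP[->|->]] //; apply/asboolP; left.
Qed.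

(* As in M. E. Rudin's proof of Stone's theorem, the sets [E n] cover the space and
   the map [m] is constant on subsets of [E n] of diameter less than [r n].  Hence
   one clopen set [W n] between [E n] and its [r n / 3]-neighbourhood suffices for
   each [n]: a point of [W n] gets the index of a nearby point of [E n]. *)
Lemma clopen_partition_refinement (T : topologicalType) (I : Type) (U : I -> set T) :
  strongly_zero_dim T -> metrizable T ->
  (forall i, open (U i)) -> (forall x, exists i, U i x) ->
  exists2 p : T -> I, locally_constant p & forall x, U (p x) x.
Proof.
move=> dim0 [d Md] oU Ucov.
have [m [mU mE]] := exists_minimal_choice Ucov.
pose r n : RR := n.+1%:R^-1.
have r0 n : 0 < r n by rewrite invr_gt0.
pose E n := [set x | forall y, d x y < r n -> U (m x) y].
have Emeet n x y : E n x -> E n y -> d x y < r n -> m x = m y.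
  by move=> Ex Ey xy; apply: mE; [exact: Ex|apply: Ey; rewrite (Met_sym Md)].
have Ecl n : closed (E n).
  rewrite -openC; apply/(proj2 Md) => x /existsNP[z /not_implyP[xz zU]].
  have [e e0 eU] := (proj1 (proj2 Md _) (oU (m x))) x (mU x).
  (* A point [y] of [E n] this close to [x] would have the same index as [x] and have [z] in its
     [r n]-ball, forcing [z] into [U (m x)]. *)
  exists (Num.min e (r n - d x z)); first by rewrite lt_min e0 subr_gt0.
  move=> y; rewrite lt_min => /andP[/eU yU xyr] Ey; apply: zU.
  have -> : m x = m y.
    apply: mE => //; apply: Ey; rewrite (Met_sym Md).
    by have := Met_ge0 Md x z; lra.
  by apply: Ey; have := Met_triangle Md x y z; rewrite (Met_sym Md y x); lra.
pose G n := [set y | exists2 x, E n x & d x y < r n / 3].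
have Gop n : open (G n).
  have -> : G n = \bigcup_(x in E n) [set y | d x y < r n / 3] by [].
  by apply: bigcup_open => x _; exact: Met_ball_open.
have sep n : exists W : set T, clopen W /\ E n `<=` W /\ W `<=` G n.
  have [||W [cW [EW WG]]] := dim0 (E n) (~` G n) (Ecl n).
  - exact: open_closedC.
  - rewrite -subset0 => x [Ex]; apply; exists x => //.
    by rewrite (Met_xx Md) divr_gt0.
  - by exists W; split=> //; split=> //; exact/subsets_disjoint.
have [W WP] := choice sep.
(* Outside [W n] the value of [c] is irrelevant; [x] is a default. *)
have /choice[c cP] : forall nx : nat * T, exists z, W nx.1 nx.2 ->
    E nx.1 z /\ d z nx.2 < r nx.1 / 3.
  move=> [n x] /=; have [Wx|nWx] := pselect (W n x); last by exists x.
  by have [z ? ?] := (WP n).2.2 x Wx; exists z.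
(* [N x] is the least [n] with [x] in [W n]; it is locally constant because the [W n] are clopen. *)
have /choice[N NP] : forall x, exists n, W n x /\ forall k : 'I_n, ~ W k x.
  move=> x; have [e e0 eU] := (proj1 (proj2 Md _) (oU (m x))) x (mU x).
  have [n0 n0e] := exists_invS_lt e0.
  have ex : exists n, `[< W n x >].
    exists n0; apply/asboolP/(WP n0).2.1 => y xy; apply: eU.
    exact: lt_trans xy _.
  case: (ex_minnP ex) => n /asboolP Wn minn; exists n; split=> // -[k kn] /= /asboolP/minn.
  by rewrite leqNgt kn.
exists (fun x => m (c (N x, x))) => [x|x]; last first.
  have [Ec cx] := cP (N x, x) (NP x).1; apply: Ec.
  by rewrite /= in cx *; have := r0 (N x); lra.
have [Wx nWx] := NP x.
have near_out : \forall y \near x, forall k : 'I_(N x), ~ W k y.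
  apply: filter_forall => k; apply: open_nbhs_nbhs; split; last exact: nWx.
  by apply: closed_openC; case: (WP k) => -[].
have near_in : \forall y \near x, W (N x) y.
  by apply: open_nbhs_nbhs; split=> //; case: (WP (N x)) => -[].
have near_r : \forall y \near x, d x y < r (N x) / 3.
  by apply/(Met_nbhsP Md); exists (r (N x) / 3) => //; rewrite divr_gt0.
apply: filterS3 near_out near_in near_r => y out Wy xy.
have NE : N y = N x.
  have [Wy' out'] := NP y; case: (ltngtP (N y) (N x)) => // lt.
    by case: (out (Ordinal lt)).
  by case: (out' (Ordinal lt)).
rewrite NE.
(* Three distances below [r n / 3], along the path through [x] and [y], put the two chosen points of
   [E n] within [r n] of each other. *)
have [Ecx cx] := cP (N x, x) Wx; have [Ecy cy] := cP (N x, y) Wy.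
apply: (Emeet (N x)) => //; rewrite /= in cx cy *.
have := Met_triangle Md y (c (N x, y)) (c (N x, x)).
have := Met_triangle Md x y (c (N x, x)).
rewrite (Met_sym Md y x) (Met_sym Md x (c _)); lra.
Qed.

(** Refine the cover by [e]-balls indexed by their centres: the index of [x] is a point within [e]
    of it. *)
Lemma locally_constant_approx (T : topologicalType) (d : T -> T -> RR) (e : RR) :
  strongly_zero_dim T -> Met T d -> 0 < e ->
  exists2 p : T -> T, locally_constant p & forall x, d (p x) x < e.
Proof.
move=> dim0 Md e0.
apply: (@clopen_partition_refinement _ _ (fun c => [set x | d c x < e])) => //.
- by exists d.
- by move=> c; exact: Met_ball_open.
- by move=> x; exists x; rewrite /= (Met_xx Md).
Qed.

(** * Separating pairs by locally constant maps *)

(** [code x] is the Dedekind cut of [f x], read along an enumeration of the rationals. *)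
Lemma continuum_code (T : Type) : card_le_continuum T ->
  exists code : T -> nat -> bool, forall x y, code x =1 code y -> x = y.
Proof.
move=> [f f_inj].
exists (fun x n => if unpickle n is Some q then f x < ratr (q : rat) else false).
move=> x y codeE; apply: f_inj; apply: contrapT => /eqP.
rewrite neq_lt => /orP[] /rat_in_itvoo[q]; rewrite in_itv /= => /andP[fq qf];
  have := codeE (pickle q); rewrite pickleK.
- by rewrite fq ltNge (ltW qf).
- by rewrite [in RHS]fq ltNge (ltW qf).
Qed.

(** Stated for all large [N], so that several pairs can share one prefix length. *)
Lemma mkseq_separates (T : Type) (code : T -> nat -> bool) x y :
  (forall x y, code x =1 code y -> x = y) -> x <> y ->
  \forall N \near \oo, mkseq (code y) N != mkseq (code x) N.
Proof.
move=> code_inj xy.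
have [n cn] : exists n, code x n <> code y n.
  by apply/not_existsP => cE; apply: xy; apply: code_inj => n; exact: contrapT (cE n).
exists n.+1 => // N /= nN; apply/eqP => /(congr1 (nth false ^~ n)).
by rewrite !nth_mkseq// => /esym.
Qed.

Lemma locally_constant_mkseq (T : topologicalType) (A : Type) (c : T -> nat -> A) N :
  (forall n, locally_constant (c ^~ n)) -> locally_constant (fun x => mkseq (c x) N).
Proof.
move=> c_lc x.
have : \forall y \near x, forall k : 'I_N, c y k = c x k.
  by apply: filter_forall => k; exact: c_lc.
apply: filterS => y cE; apply/eq_in_map => k; rewrite mem_iota add0n => /andP[_ kN].
exact: (cE (Ordinal kN)).
Qed.

(** In the perturbed metric, the first two properties keep the topology unchanged, and the third
    lets the digits of a pair of distinct points determine that pair. *)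
Lemma separating_family (T : topologicalType) (d : T -> T -> RR) :
  strongly_zero_dim T -> Met T d -> card_le_continuum T ->
  exists h : nat -> T -> T + bool,
  [/\ forall n, locally_constant (h n),
      forall e : RR, 0 < e -> exists n, forall x y, h n x = h n y -> d x y < e &
      forall x y u v, x <> y -> [set x; y] <> [set u; v] ->
        exists n, ~ (h n x = h n y <-> h n u = h n v)].
Proof.
move=> dim0 Md /continuum_code[code code_inj].
have /choice[p pP] : forall m, exists p : T -> T,
    locally_constant p /\ forall x, d (p x) x < (m.+1%:R^-1 : RR).
  by move=> m; have [|p] := @locally_constant_approx _ _ m.+1%:R^-1 dim0 Md; [by rewrite invr_gt0|exists p].
(* [code] need not be locally constant, but its composite with [p m] is. Interleaving these codes
   over all [m] still names points, since [p m x] tends to [x]. *)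
pose bits x n := if unpickle n is Some mk then code (p mk.1 x) mk.2 else false.
have p_close m x y : p m x = p m y -> d x y < (m.+1%:R^-1 : RR) * 2.
  move=> pE; have := (pP m).2 x; have := (pP m).2 y; rewrite pE (Met_sym Md _ x).
  have := Met_triangle Md (p m y) x y; move: (m.+1%:R^-1) => r; lra.
have bits_inj x y : bits x =1 bits y -> x = y.
  move=> bE; apply/(Met_eq0 Md)/eqP; rewrite eq_le (Met_ge0 Md) andbT.
  apply/ler_addgt0Pr => e e0; rewrite add0r; have [m me] := exists_invS_lt (divr_gt0 e0 (ltr0Sn _ 1)).
  have : p m x = p m y.
    by apply: code_inj => k; have := bE (pickle (m, k)); rewrite /bits pickleK.
  by move=> /p_close xyE; apply/ltW/(lt_trans xyE); rewrite -ltr_pdivlMr.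
have bits_lc n : locally_constant (bits ^~ n).
  move=> x; rewrite /bits; case: (unpickle n) => [[m k]|]; last exact: filterE.
  by apply: filterS ((pP m).1 x) => y ->.
(* The [inl] maps control the topology; the [inr] ones are the indicators of the
   cylinders of [bits], which isolate a point from finitely many others. *)
pose h n : T -> T + bool :=
  match unpickle n with
  | Some (inl m) => fun x => inl (p m x)
  | Some (inr s) => fun x => inr (mkseq (bits x) (size (s : seq bool)) == s)
  | None => fun=> inr false
  end.
exists h; split=> [n x|e e0|x y u v xy xyuv].
- rewrite /h; case: (unpickle n) => [[m|s]|]; last exact: filterE.
    by apply: filterS ((pP m).1 x) => y ->.
  by apply: filterS (locally_constant_mkseq (size s) bits_lc x) => y ->.
- have [m me] := exists_invS_lt (divr_gt0 e0 (ltr0Sn _ 1)).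
  exists (pickle (inl m : nat + seq bool)) => x y.
  rewrite /h pickleK => -[/p_close xyE]; apply: lt_trans xyE _.
  by rewrite -ltr_pdivlMr.
(* A cylinder containing [a] but none of [b], [u], [v] has an indicator that separates [a] from [b]
   and not [u] from [v]. *)
- have isolate a b : a <> b -> a <> u -> a <> v -> exists n,
      [/\ h n a <> h n b & h n u = h n v].
    move=> /(mkseq_separates bits_inj) ab /(mkseq_separates bits_inj) au.
    move=> /(mkseq_separates bits_inj) av.
    have /filter_ex[N [bN uN vN]] : \forall N \near \oo,
        [/\ mkseq (bits b) N != mkseq (bits a) N, mkseq (bits u) N != mkseq (bits a) N &
             mkseq (bits v) N != mkseq (bits a) N].
      by apply: filterS3 ab au av.
    exists (pickle (inr (mkseq (bits a) N) : nat + seq bool)).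
    rewrite /h pickleK size_mkseq eqxx.
    by rewrite (negbTE bN) (negbTE uN) (negbTE vN).
  (* If neither [x] nor [y] avoids both [u] and [v], the distinct points [x] and [y] exhaust
     [{u, v}]. *)
  have [xuv|] := pselect (x <> u /\ x <> v).
    by have [n [? ?]] := isolate x y xy xuv.1 xuv.2; exists n; tauto.
  have [yuv|] := pselect (y <> u /\ y <> v).
    have [n [nyx uvE]] := isolate y x (nesym xy) yuv.1 yuv.2.
    by exists n => xyE; apply: nyx; apply/esym/xyE.
  move=> /not_andP yuv /not_andP xuv; case: xyuv; move: xy.
  case: xuv => /contrapT ->; case: yuv => /contrapT -> // _; exact: setUC.
Qed.

(** * Perturbed metrics and density *)

Lemma exists_expr4V_lt (R : realType) (e : R) : 0 < e -> exists n, (4 ^+ n)^-1 < e.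
Proof.
move=> /exists_invS_lt[n ne]; exists n; apply: le_lt_trans ne.
by rewrite lef_pV2 ?posrE ?exprn_gt0// -natrX ler_nat ltn_expl.
Qed.

Section Perturbation.
Variables (T : topologicalType) (A : Type) (d : T -> T -> RR) (h : nat -> T -> A).
Hypothesis Md : Met T d.
Hypothesis h_lc : forall n, locally_constant (h n).
Hypothesis h_fine : forall e : RR, 0 < e -> exists n, forall x y, h n x = h n y -> d x y < e.

Definition sep_digits x y n := `[< h n x <> h n y >].

Lemma sep_digitsPn x y n : sep_digits x y n = false <-> h n x = h n y.
Proof.
split=> [/asboolPn/contrapT //|hE].
by apply/asboolPn => /(_ hE).
Qed.

(** [P] vanishes near the diagonal, so the digit sum alone decides both the topology and the
    separation of points. *)
Lemma perturbed_Met (P : T -> T -> RR) (c : RR) :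
  0 < c -> (forall x y, 0 <= P x y) -> (forall x y, P x y = P y x) ->
  (forall x y z, P x z <= P x y + P y z) ->
  (forall x, \forall y \near x, P x y = 0) ->
  Met T (fun x y => P x y + c * digit_sum RR (sep_digits x y)).
Proof.
move=> c0 P_ge0 P_sym P_triangle P_near.
pose w x y := digit_sum RR (sep_digits x y).
have cw_ge0 x y : 0 <= c * w x y by rewrite mulr_ge0 ?digit_sum_ge0// ltW.
have fine (e : RR) : 0 < e -> exists2 r, 0 < r & forall x y, P x y + c * w x y < r -> d x y < e.
  (* A nonzero [n]-th digit contributes at least this much, so a smaller value forces
     [h n x = h n y]. *)
  move=> /h_fine[n hn]; exists (c * (4 ^+ n.+1)^-1).
    by rewrite mulr_gt0// invr_gt0 exprn_gt0.
  move=> x y xyr; apply: hn; apply/sep_digitsPn/negbTE/negP => /(digit_sum_large RR).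
  rewrite leNgt -(ltr_pM2l c0) => /negP; apply; apply: le_lt_trans xyr.
  by rewrite lerDr.
split; first split=> [x y|].
- by apply: addr_ge0 => //; exact: cw_ge0.
- split=> [x y|].
    split=> [xy0|<-].
      apply/(Met_eq0 Md)/eqP; rewrite eq_le (Met_ge0 Md) andbT.
      by apply/ler_addgt0Pr => e /fine[r r0 re]; rewrite add0r; apply/ltW/re; rewrite /w xy0.
    have -> : P x x = 0 by exact: nbhs_singleton (P_near x).
    by rewrite digit_sum0 ?mulr0 ?addr0// => n; exact/sep_digitsPn.
  split=> [x y|x y z].
    rewrite P_sym; congr (_ + c * digit_sum _ _); apply/funext => n.
    by apply: asbool_equiv_eq; split; exact: nesym.
  rewrite addrACA lerD// -mulrDr ler_pM2l//.
  apply: digit_sum_triangle => n; apply: contraTT; rewrite negb_or.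
  by move=> /andP[/negbTE/sep_digitsPn xy /negbTE/sep_digitsPn yz]; apply/negbT/sep_digitsPn; rewrite xy.
- move=> B; split=> [oB x Bx|B_ball].
    have [e e0 eB] := (proj1 (proj2 Md B) oB) x Bx.
    by have [r r0 re] := fine e e0; exists r => // y /re/eB.
  rewrite openE => x /B_ball[r r0 rB].
  (* Near [x] the first [N] digits vanish, leaving a digit sum of at most [1 / 4 ^ N]. *)
  have [N Nr] := exists_expr4V_lt (divr_gt0 r0 c0).
  have near_h : \forall y \near x, forall k : 'I_N, h k y = h k x.
    by apply: filter_forall => k; exact: h_lc.
  apply: filterS2 (P_near x) near_h => y Pxy hE; apply: rB.
  rewrite Pxy add0r mulrC -ltr_pdivlMr//; apply: le_lt_trans Nr.
  apply: digit_sum_small => k kN; apply/sep_digitsPn.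
  exact/esym/(hE (Ordinal kN)).
Qed.

End Perturbation.

Lemma SR_dense (T : topologicalType) :
  strongly_zero_dim T -> card_le_continuum T -> Met_dense (SR T).
Proof.
move=> dim0 cT; split=> [d []//|d Md eps eps0].
(* Moving both points costs less than [2 * c], rounding less than [c], the digits less than [c / 2]:
   in all below [4 * c < eps]. *)
pose c := eps / 5; have c0 : 0 < c by rewrite divr_gt0.
have [p p_lc pd] := locally_constant_approx dim0 Md c0.
have [h [h_lc h_fine h_sep]] := separating_family dim0 Md cT.
pose m x y := Num.ceil (d (p x) (p y) / c).
have m_bounds x y : d (p x) (p y) <= c * (m x y)%:~R < d (p x) (p y) + c.
  have := ceil_itv (d (p x) (p y) / c); rewrite -/(m x y) => /andP[].
  rewrite ltr_pdivlMr// ler_pdivrMr// rmorphB /= => lt le.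
  by apply/andP; split; lra.
pose e x y := c * (m x y)%:~R + c * digit_sum RR (sep_digits h x y).
have Me : Met T e.
  apply: (perturbed_Met Md h_lc h_fine) => //.
  - move=> x y; apply: mulr_ge0; [exact: ltW|rewrite ler0z ceil_ge0].
    by apply: lt_le_trans (divr_ge0 (Met_ge0 Md _ _) (ltW c0)).
  - by move=> x y; rewrite /m (Met_sym Md).
  (* Rounding up preserves the triangle inequality: a sum of two ceilings is an integer above the
     sum of the arguments. *)
  - move=> x y z; rewrite -mulrDr ler_pM2l// -intrD ler_int ceil_le_int intrD.
    apply: le_trans (lerD (ceil_ge _) (ceil_ge _)).
    by rewrite -mulrDl ler_pM2r ?invr_gt0//; exact: Met_triangle.
  - move=> x; apply: filterS (p_lc x) => y pE.
    by rewrite /m pE (Met_xx Md) mul0r ceil0 mulr0.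
exists e.
  split=> // x y u v; rewrite /e -!mulrDr => /(mulfI (lt0r_neq0 c0)).
  move=> /int_plus_digits_inj gE xy0; apply: contrapT.
  have xy : x <> y.
    by move=> /(Met_eq0 Me) xyE; move: xy0; rewrite mulrDr -/(e x y) xyE eqxx.
  move=> /(h_sep _ _ _ _ xy)[n]; apply.
  by rewrite -!sep_digitsPn gE.
apply: (@le_lt_trans _ _ (c * 4)%:E); last by rewrite lte_fin /c; lra.
apply: ge_ereal_sup => _ [[x y] _ <-] /=; rewrite lee_fin ler_norml /e.
have := digit_sum_ge0 RR (sep_digits h x y).
have := digit_sum_lt_half RR (sep_digits h x y).
rewrite -(ltr_pM2l c0) -(ler_pM2l c0) mulr0; move: (c * digit_sum _ _) => w w1 w0.
have := m_bounds x y; move: (c * _) => k kb.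
have := pd x; have := pd y.
have := Met_triangle Md (p x) x y; have := Met_triangle Md (p y) (p x) y.
have := Met_triangle Md x (p x) (p y); have := Met_triangle Md y x (p y).
rewrite (Met_sym Md x (p x)) (Met_sym Md y (p y)); lra.
Qed.

(** * Open conditions on compact sets and the G_delta property *)

Lemma Met_continuous (S T : topologicalType) (d : T -> T -> RR) (f g : S -> T) :
  Met T d -> continuous f -> continuous g -> continuous (fun s => d (f s) (g s)).
Proof.
move=> Md cf cg s; apply/(@cvgrPdist_lt RR RR^o) => e e0 /=.
have near_ball z : \forall w \near z, d z w < e / 2.
  by apply/(Met_nbhsP Md); exists (e / 2) => //; rewrite divr_gt0.
have near_f : \forall s' \near s, d (f s) (f s') < e / 2 by exact: cf (near_ball (f s)).
have near_g : \forall s' \near s, d (g s) (g s') < e / 2 by exact: cg (near_ball (g s)).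
apply: filterS2 near_f near_g => s'.
rewrite /= ltr_norml; set x := f s; set y := g s; set x' := f s'; set y' := g s' => xx yy.
have := Met_triangle Md x' x y; have := Met_triangle Md y' x' y.
have := Met_triangle Md x x' y'; have := Met_triangle Md y x y'.
rewrite (Met_sym Md x' x) (Met_sym Md y' y); lra.
Qed.

Lemma coordinates_continuous (T : topologicalType) :
  [/\ continuous (fun q : (T * T) * (T * T) => q.1.1),
      continuous (fun q : (T * T) * (T * T) => q.1.2),
      continuous (fun q : (T * T) * (T * T) => q.2.1) &
      continuous (fun q : (T * T) * (T * T) => q.2.2)].
Proof.
by split=> q; apply: (cvg_comp _ _ (G := nbhs _)); first [exact: cvg_fst|exact: cvg_snd].
Qed.

Lemma supdist_lt (T : Type) (d e : T -> T -> RR) (r : RR) x y :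
  (supdist d e < r%:E)%E -> `|d x y - e x y| < r.
Proof.
rewrite -lte_fin; apply: le_lt_trans; apply: ereal_sup_ubound.
by exists (x, y).
Qed.

(** By compactness the gap between the two distances has a positive lower bound [eta] on [L];
    changing each distance by less than [eta / 2] cannot close it. *)
Lemma Met_open_neq_on_compact (T : topologicalType) (L : set ((T * T) * (T * T))) :
  compact L ->
  Met_open [set d | Met T d /\ forall q, L q -> d q.1.1 q.1.2 <> d q.2.1 q.2.2].
Proof.
move=> cL; split=> [d []//|d [Md dL]].
pose F (q : (T * T) * (T * T)) := `|d q.1.1 q.1.2 - d q.2.1 q.2.2|.
have [eta eta0 Feta] : exists2 eta : RR, 0 < eta & forall q, L q -> eta <= F q.
  have [[q0 Lq0]|L0] := pselect (L !=set0); last first.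
    by exists 1 => // q Lq; case: L0; exists q.
  have cF : continuous F.
    have [c11 c12 c21 c22] := coordinates_continuous T.
    by move=> q; apply: (@cvg_norm RR RR^o); apply: (@cvgB RR RR^o); exact: Met_continuous.
  have [q Lq qmin] := compact_EVT_min (ex_intro _ q0 Lq0) cL (continuous_subspaceT cF).
  exists (F q).
    by rewrite normr_gt0 subr_eq0; apply/eqP/dL; rewrite inE in Lq.
  by move=> q' Lq'; apply: qmin; rewrite inE.
exists (eta / 2) => [|e Me de]; first by rewrite divr_gt0.
split=> // q Lq eE; have := Feta q Lq.
have := supdist_lt q.1.1 q.1.2 de; have := supdist_lt q.2.1 q.2.2 de.
rewrite /F !eE !ltr_norml ler_normr; lra.
Qed.

Lemma SR_Gdelta (T : topologicalType) :
  metrizable T -> sigma_compact T -> Met_Gdelta (SR T).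
Proof.
move=> [d0 M0] [K [cK Kcov]].
pose Q := ((T * T) * (T * T))%type.
(* For [r > 0] these conditions bound a quadruple away from [x = y], from [(x, y) = (u, v)] and from
   [(x, y) = (v, u)]. Being closed, they keep the pieces [L n] compact. *)
pose far (r : RR) := [set q : Q |
  [/\ r <= d0 q.1.1 q.1.2, r <= d0 q.1.1 q.2.1 + d0 q.1.2 q.2.2 &
      r <= d0 q.1.1 q.2.2 + d0 q.1.2 q.2.1]].
have far_closed r : closed (far r).
  have -> : far r = [set q | r <= d0 q.1.1 q.1.2] `&`
      ([set q | r <= d0 q.1.1 q.2.1 + d0 q.1.2 q.2.2] `&`
       [set q | r <= d0 q.1.1 q.2.2 + d0 q.1.2 q.2.1]).
    by apply/seteqP; split=> q; [case|move=> [? []]].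
  have cd f g : continuous f -> continuous g -> continuous (fun q : Q => d0 (f q) (g q)).
    exact: Met_continuous.
  have cl (f : Q -> RR) : continuous f -> closed [set q : Q | r <= f q].
    by move=> /continuous_closedP cf; exact: (cf _ (@closed_ge RR r)).
  have [c11 c12 c21 c22] := coordinates_continuous T.
  apply: closedI; [|apply: closedI]; apply: cl => q.
  - exact: cd.
  - by apply: (@cvgD RR RR^o); apply: cd.
  - by apply: (@cvgD RR RR^o); apply: cd.
(* An index encodes four compact sets and a bound [1 / m.+1]; a non-code gives the empty set, hence
   a vacuous condition. *)
pose L n : set Q :=
  match unpickle n with
  | Some (i, j, k, l, m) => ((K i `*` K j) `*` (K k `*` K l)) `&` far (m.+1%:R^-1)
  | None => set0
  end.
have cL n : compact (L n).
  rewrite /L; case: (unpickle n) => [[[[[i j] k] l] m]|]; last exact: compact0.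
  by apply: compact_closedI => //; do !apply: compact_setX.
exists (fun n => [set d | Met T d /\ forall q, L n q -> d q.1.1 q.1.2 <> d q.2.1 q.2.2]).
split=> [n|]; first exact: Met_open_neq_on_compact.
have invS0 m : (0 : RR) < m.+1%:R^-1 by rewrite invr_gt0.
apply/seteqP; split=> [d [Md dSR] n _|d dU].
  split=> // -[[x y] [u v]] /=; rewrite /L.
  case: (unpickle n) => [[[[[i j] k] l] m]|] // [_ [/=]].
  move=> /(lt_le_trans (invS0 m)) xy /(lt_le_trans (invS0 m)) xuyv.
  move=> /(lt_le_trans (invS0 m)) xvyu /dSR.
  have xNy : x <> y by move=> xy'; move: xy; rewrite xy' (Met_xx M0) ltxx.
  have dxy : d x y != 0 by apply/eqP => /(Met_eq0 Md).
  (* Rigidity would match [x], [y] with [u], [v] in one of the two orders, making one of the sums in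
     [far] zero. *)
  move=> /(_ dxy) E; have xuv : [set u; v] x by rewrite -E; left.
  have yuv : [set u; v] y by rewrite -E; right.
  move: xNy xuyv xvyu.
  by case: xuv => ->; case: yuv => -> // _; rewrite !(Met_xx M0) addr0 ltxx.
have Md : Met T d by case: (dU 0).
split=> // x y u v dE dxy; apply: contrapT => xyuv.
have xNy : x <> y by move=> /(Met_eq0 Md) E; rewrite E eqxx in dxy.
have cov z : exists i, K i z.
  by have [i _ Kz] : (\bigcup_n K n) z; [rewrite Kcov|exists i].
have [i Ki] := cov x; have [j Kj] := cov y; have [k Kk] := cov u; have [l Kl] := cov v.
have pos z w z' w' : ~ (z = z' /\ w = w') -> 0 < d0 z z' + d0 w w'.
  move=> zw; rewrite lt_def addr_ge0 ?(Met_ge0 M0)// andbT paddr_eq0 ?(Met_ge0 M0)//.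
  by apply/andP => -[/eqP/(Met_eq0 M0) ? /eqP/(Met_eq0 M0) ?]; apply: zw.
pose r := Num.min (d0 x y) (Num.min (d0 x u + d0 y v) (d0 x v + d0 y u)).
have [m] : exists m, m.+1%:R^-1 < r.
  apply: exists_invS_lt; rewrite !lt_min; apply/and3P; split.
  - by rewrite lt_def (Met_ge0 M0) andbT; apply/eqP => /(Met_eq0 M0).
  - by apply: pos => -[xu yv]; apply: xyuv; rewrite xu yv.
  - by apply: pos => -[xv yu]; apply: xyuv; rewrite xv yu setUC.
rewrite !lt_min => /and3P[m1 m2 m3].
have [_ /(_ ((x, y), (u, v)))] := dU (pickle (i, j, k, l, m)) I; apply=> //.
by rewrite /L pickleK; do !split => //=; exact: ltW.
Qed.

Theorem theorem1p2 (T : topologicalType) :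
  strongly_zero_dim T -> metrizable T -> card_le_continuum T ->
  Met_dense (SR T) /\ (sigma_compact T -> Met_dense (SR T) /\ Met_Gdelta (SR T)).
Proof.
move=> dim0 Tmet cT; split=> [|sT]; first exact: SR_dense.
by split; [exact: SR_dense|exact: SR_Gdelta].
Qed.
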